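(* Let $n\ge 1$ and $0\leq k\leq n$ be integers. The number of parking functions of length $n$ with exactly $k$ fixed points is $$\frac{1}{(n+1)^2} \binom{n+1}{k} \left(n^{n-k+1}-(-1)^{n-k+1}\right).$$
   Context: A parking function of length $n$ is a sequence $\pi=(\pi_1,\dots,\pi_n)$ of positive integers such that, if $\lambda_1\le\cdots\le\lambda_n$ is the weakly increasing rearrangement of $\pi_1,\dots,\pi_n$, then $\lambda_i\le i$ for all $1\le i\le n$. An index $i\in\{1,\dots,n\}$ is a fixed point of $\pi$ if $\pi_i=i$. *)

(* Defs.v *)
From mathcomp Require Import all_boot all_order all_algebra.

Set Implicit Arguments.
Unset Strict Implicit.
Unset Printing Implicit Defensive.

(* Sequences are indexed from 0 in the library, so the entry written pi_i
   (1 <= i <= n) on paper is nth 0 s i.-1; below, the 1-based index is i.+1. *)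

Definition parking_function (s : seq nat) : bool :=
  all (leq 1) s && [forall i : 'I_(size s), nth 0 (sort leq s) i <= i.+1].

Definition fixed_points (s : seq nat) : {set 'I_(size s)} :=
  [set i : 'I_(size s) | nth 0 s i == i.+1].

Lemma parking_function_le_size (s : seq nat) (x : nat) :
  parking_function s -> x \in s -> x <= size s.
Proof.
case/andP=> _ /forallP le_s; rewrite -(mem_sort leq) => /(nthP 0)[i].
rewrite size_sort => lt_i_s <-.
exact: leq_trans (le_s (Ordinal lt_i_s)) lt_i_s.
Qed.

(* By parking_function_le_size, taking the entries in {0, ..., n} loses no
   parking function of length n; it only makes the ambient type finite. *)
Definition parking_functions_with_fixed_points (n k : nat) :
    {set n.-tuple 'I_n.+1} :=
  [set p : n.-tuple 'I_n.+1 |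
     let s := [seq val x | x <- p] in
     parking_function s && (#|fixed_points s| == k)].

(* Main.v *)
(* Entries are shifted to Z/(n+1) = {0, ..., n}, so that pi_i = i becomes
   f i = i.  Pollak's cycle argument: every f : {0, ..., n-1} -> Z/(n+1) has
   exactly one translate that is a parking function, so a translation invariant
   sum over all functions is n+1 times the sum over parking functions.

   Let g_k count the parking functions with k fixed points.  Parking functions
   are stable under permuting positions, so n! g_k also counts the pairs (f, s)
   with s in S_n and f i = s i for exactly k indices i.  Replace s by t in
   S_(n+1), obtained from s by composing on the right with the transposition
   (x n), where x ranges over {0, ..., n}: a parking function never takes the
   value n, so if x is an agreement of f and s it is lost, and otherwise nothing
   changes.  Hence n! ((n+1-k) g_k + (k+1) g_(k+1)) counts the pairs (f, t) with
   exactly k agreements.  That count, for fixed f, is translation invariant,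
   whence
     (n+1-k) g_k + (k+1) g_(k+1) = C(n, k) n^(n-k),
   and downward induction on k from g_(n+1) = 0 gives the formula. *)
Require Import Defs.
From mathcomp Require Import all_boot all_order all_algebra.
From mathcomp Require Import all_fingroup zify ring.

Import GRing.Theory.
Local Open Scope ring_scope.

(** * Pollak's cycle argument *)

Definition below {n} (f : {ffun 'I_n -> 'I_n.+1}) (d : 'I_n.+1) : nat :=
  \sum_i (f i < d)%N.

(** The sorted condition in shifted form: d = 0 is vacuous, and d = n forbids the value n. *)
Definition park {n} (f : {ffun 'I_n -> 'I_n.+1}) : bool :=
  [forall d : 'I_n.+1, (d <= below f d)%N].

Definition translate {n} (c : 'I_n.+1) (f : {ffun 'I_n -> 'I_n.+1}) :
  {ffun 'I_n -> 'I_n.+1} := [ffun i => f i + c].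

Definition agreements {n} (f : {ffun 'I_n -> 'I_n.+1}) (g : 'I_n -> 'I_n.+1) : nat :=
  #|[set i | f i == g i]|.

(** [lift ord_max] embeds {0, ..., n-1} into {0, ..., n}, so these agreements are the fixed
    points. *)
Definition park_count n (k : nat) : nat :=
  (\sum_(f : {ffun 'I_n -> 'I_n.+1} | park f)
    (agreements f (lift ord_max) == k))%N.

Lemma val_subord n (a b : 'I_n.+1) :
  (a - b : 'I_n.+1) = (if b <= a then a - b else n.+1 + a - b)%N :> nat.
Proof.
rewrite /= modnDmr; have la := ltn_ord a; have lb := ltn_ord b.
case: (leqP b a) => ab; last by rewrite modn_small; lia.
by rewrite (_ : a + (n.+1 - b) = (a - b) + n.+1)%N ?modnDr ?modn_small; lia.
Qed.

Lemma park_shift n (f : {ffun 'I_n -> 'I_n.+1}) :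
  exists c0, forall c, park (translate (- c) f) = (c == c0).
Proof.
pose N := below f.
have leN d : (N d <= n)%N.
  rewrite -[X in (_ <= X)%N]card_ord -sum1_card; apply: leq_sum => i _.
  by case: (_ < _)%N.
(* Lexicographic order on (N d - d, d): its minimum is the first place where
   the height N d - d of the lattice path of f is minimal. *)
pose E (d : 'I_n.+1) := (n.+1 * (N d + n.+1 - d) + d)%N.
have parkE c : park (translate (- c) f) = [forall d, (E c <= E d)%N].
  (* For c <= d, S = N d - N c and the condition reads N c - c <= N d - d. For d < c the wrap-around
     gives S = n + N d - N c, so the inequality becomes strict, which is what the tie-break in [E]
     encodes. *)
  have pointwise (d : 'I_n.+1) :
      ((d - c)%R <= below (translate (- c)%R f) (d - c)%R)%N = (E c <= E d)%N.
    have := leN c; have := leN d; have := ltn_ord c; have := ltn_ord d.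
    set S := below _ _; rewrite val_subord.
    case: (leqP c d) => cd ltd ltc leNd leNc.
      have eqS : (S + N c = N d)%N.
        rewrite -big_split; apply: eq_bigr => i _.
        rewrite !ffunE !val_subord cd /=; have := ltn_ord (f i); case: (leqP c (f i)); lia.
      rewrite /E; nia.
    have : (S + N c = \sum_(i < n) 1 + N d)%N.
      rewrite -!big_split; apply: eq_bigr => i _.
      rewrite !ffunE !val_subord (leqNgt c d) cd /=; have := ltn_ord (f i).
      case: (leqP c (f i)); lia.
    rewrite sum1_card card_ord => eqS.
    rewrite /E; nia.
  apply/forallP/forallP => H d; first by rewrite -pointwise; apply: H.
  by have := H (d + c); rewrite -pointwise addrK.
have Einj : injective E.
  move=> c d /(congr1 (modn^~ n.+1)).
  by rewrite /E /= ![(n.+1 * _)%N]mulnC !modnMDl !modn_small // => /val_inj.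
exists [arg min_(c < ord0) E c] => c; rewrite parkE.
case: arg_minnP => // c0 _ minc0; apply/forallP/eqP => [minc | -> d]; last exact: minc0.
by apply: Einj; apply/eqP; rewrite eqn_leq minc minc0.
Qed.

Lemma translateK n (c : 'I_n.+1) : cancel (translate c) (translate (- c)).
Proof. by move=> f; apply/ffunP => i; rewrite !ffunE addrK. Qed.

(** Double counting of the pairs (f, c) for which [translate (- c) f] is parking. *)
Lemma sum_park n (F : {ffun 'I_n -> 'I_n.+1} -> nat) :
  (forall f c, F (translate c f) = F f) ->
  (\sum_f F f = n.+1 * \sum_(f | park f) F f)%N.
Proof.
move=> Fshift.
transitivity (\sum_f \sum_(c | park (translate (- c)%R f)) F f)%N.
  apply: eq_bigr => f _; have [c0 Hc0] := park_shift _ f.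
  by under eq_bigl do rewrite Hc0; rewrite big_pred1_eq.
rewrite (exchange_big_dep predT) //=.
rewrite -[X in (X * _)%N](card_ord n.+1) -sum_nat_const.
apply: eq_bigr => c _; rewrite (reindex (translate c)).
  by apply: eq_big => [f | f _]; rewrite ?translateK ?Fshift.
exists (translate (- c)) => f _; first exact: translateK.
by rewrite -{1}(opprK c) translateK.
Qed.

(** * Counting agreements: all functions, then S_n against S_(n+1) *)

Lemma card_agreements n k (g : 'I_n -> 'I_n.+1) :
  (\sum_f (agreements f g == k) = 'C(n, k) * n ^ (n - k))%N.
Proof.
pose A (f : {ffun 'I_n -> 'I_n.+1}) := [set i | f i == g i].
have -> : 'C(n, k) = #|[set P : {set 'I_n} | #|P| == k]|.
  by rewrite card_draws card_ord.
rewrite -sum_nat_const.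
rewrite (partition_big A predT) //= [RHS]big_mkcond; apply: eq_bigr => P _.
transitivity (if #|P| == k then #|[pred f | A f == P]| else 0%N).
  case: eqP => [cardP | cardP]; first rewrite -sum1_card.
    apply: eq_big => [f | f /eqP AP]; first by rewrite inE.
    by rewrite /agreements -/(A f) AP cardP eqxx.
  by rewrite big1 // => f /eqP AP; rewrite /agreements -/(A f) AP; case: eqP.
rewrite inE; case: eqP => // cardP.
(* With agreement set P, f is forced on P and avoids one of n + 1 values elsewhere. *)
pose F i := if i \in P then pred1 (g i) else predC1 (g i).
rewrite (eq_card (B := family F)) => [|f]; last first.
  rewrite !inE; apply/eqP/familyP => [AP i | H].
    by rewrite /F -AP inE; case: ifP => fi; rewrite !inE fi.
  apply/setP => i; rewrite inE; have := H i; rewrite /F.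
  by case: ifP => _; rewrite !inE // => /negbTE.
rewrite card_family foldrE big_map big_enum /= (bigID (mem P)) /=.
rewrite big1 => [|i iP]; last by rewrite /F iP card1.
rewrite mul1n (eq_bigr (fun=> n)) => [|i /negbTE iP]; last first.
  by rewrite /F iP cardC1 card_ord.
rewrite prod_nat_const; congr (_ ^ _)%N.
have := cardC P; rewrite [X in _ = X]card_ord cardP => /(canRL (addKn k)) <-.
by apply: eq_card => i; rewrite !inE.
Qed.

Lemma park_neq_max n (f : {ffun 'I_n -> 'I_n.+1}) i : park f -> f i != ord_max.
Proof.
move/forallP/(_ ord_max); rewrite /below /= => lenS; apply/eqP => fi.
have : (\sum_i (f i < n) < \sum_(i < n) 1)%N.
  rewrite [X in (X < _)%N](bigD1 i) // [X in (_ < X)%N](bigD1 i) //= fi ltnn.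
  by rewrite add0n add1n ltnS; apply: leq_sum => j _; case: (_ < _)%N.
by rewrite sum1_card card_ord ltnNge lenS.
Qed.

Lemma park_perm n (f : {ffun 'I_n -> 'I_n.+1}) (s : {perm 'I_n}) :
  park [ffun i => f (s i)] = park f.
Proof.
apply: eq_forallb => d; congr (_ <= _)%N.
rewrite [RHS](reindex_inj (@perm_inj _ s)) /=.
by apply: eq_bigr => i _; rewrite ffunE.
Qed.

(** Precomposition with s permutes the parking functions and turns fixed points into agreements with
    s. *)
Lemma park_count_perm n k (s : {perm 'I_n}) :
  (\sum_(f : {ffun 'I_n -> 'I_n.+1} | park f)
     (agreements f (fun i => lift ord_max (s i)) == k))%N = park_count n k.
Proof.
pose h (t : {perm 'I_n}) (f : {ffun 'I_n -> 'I_n.+1}) := [ffun i => f (t i)].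
have hK (t : {perm 'I_n}) f : h t^-1%g (h t f) = f.
  by apply/ffunP => i; rewrite !ffunE permKV.
rewrite (reindex (h s)); last first.
  by exists (h s^-1%g) => f _ //; rewrite -{1}(invgK s) hK.
apply: eq_big => [f | f _]; first exact: park_perm.
congr (nat_of_bool (_ == _)); rewrite /agreements.
rewrite -[RHS](card_preimset _ (@perm_inj _ s)).
by apply: eq_card => i; rewrite !inE ffunE.
Qed.

Definition insert_max n (u : 'I_n.+1 * {perm 'I_n}) : {perm 'I_n.+1} :=
  (tperm u.1 ord_max * lift_perm ord_max ord_max u.2)%g.

(** x is the preimage of [ord_max], and s is then recovered by cancellation; the cardinalities
    agree. *)
Lemma insert_max_bij n : bijective (@insert_max n).
Proof.
apply: inj_card_bij => [[x s] [y t]|]; last first.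
  by rewrite card_prod !card_Sn card_ord factS.
have valE z r : (insert_max n (z, r)) z = ord_max.
  by rewrite permM tpermL lift_perm_id.
move=> e; have exy : x = y.
  by apply: (@perm_inj _ (insert_max n (x, s))); rewrite valE e valE.
move: e; rewrite exy => /mulgI e; congr (_, _); apply/permP => i.
by apply: (@lift_inj _ ord_max); rewrite -!(lift_perm_lift ord_max) e.
Qed.

(** The left factor acts first, so x is sent to [ord_max], a value f misses; any displaced value of
    s lands at position [ord_max], outside the domain of f. *)
Lemma agreements_insert_max n (f : {ffun 'I_n -> 'I_n.+1}) x s :
  (forall i, f i != ord_max) ->
  agreements f (fun i => insert_max n (x, s) (lift ord_max i)) =
  #|[set i | f i == lift ord_max (s i)] :\: [set i | lift ord_max i == x]|.
Proof.
move=> fmax; apply: eq_card => i; rewrite !inE permM /=.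
case: (eqVneq (lift ord_max i) x) => [<- | nx].
  by rewrite tpermL lift_perm_id (negPf (fmax i)).
by rewrite tpermD ?lift_perm_lift ?neq_lift // eq_sym.
Qed.

(** [ord_max] and the positions outside A leave A intact; each position in A removes one element. *)
Lemma sum_card_remove n k (A : {set 'I_n}) :
  (\sum_(x < n.+1) (#|A :\: [set i | lift ord_max i == x]| == k) =
   (n.+1 - k) * (#|A| == k) + k.+1 * (#|A| == k.+1))%N.
Proof.
have leA : (#|A| <= n)%N by rewrite -[X in (_ <= X)%N]card_ord max_card.
rewrite (bigD1_ord ord_max) //=.
have -> : A :\: [set i | lift ord_max i == ord_max] = A.
  by apply/setP => i; rewrite !inE eq_sym (negPf (neq_lift _ _)).
under eq_bigr => i _.
  have -> : A :\: [set j | lift ord_max j == lift ord_max i] = A :\ i.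
    by apply/setP => j; rewrite !inE (inj_eq (@lift_inj _ _)).
  over.
rewrite (bigID (mem A)) /= (eq_bigr (fun=> nat_of_bool (#|A|.-1 == k))); last first.
  by move=> i /= iA; rewrite (cardsD1 i A) iA add1n.
rewrite sum_nat_const (eq_bigr (fun=> nat_of_bool (#|A| == k))); last first.
  by move=> i /= iA; rewrite (cardsD1 i A) (negPf iA) add0n.
rewrite sum_nat_const.
have -> : #|(fun i => i \notin mem A)| = (n - #|A|)%N.
  have := cardsC A; rewrite [X in _ = X]card_ord => /(canRL (addKn _)) <-.
  by apply: eq_card => i; rewrite !inE.
move: leA; move: #|A| => a leA.
by case: (eqVneq a k) => [|neqk]; case: (eqVneq a k.+1) => /=; nia.
Qed.

Lemma park_count_rec n k :
  (((n.+1 - k) * park_count n k + k.+1 * park_count n k.+1) =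
  'C(n, k) * n ^ (n - k))%N.
Proof.
pose F (f : {ffun 'I_n -> 'I_n.+1}) : nat :=
  (\sum_(t : {perm 'I_n.+1}) (agreements f (fun i => t (lift ord_max i)) == k))%N.
have Ftrans f c : F (translate c f) = F f.
  (* Translating f by c is absorbed by following t with addition of c. *)
  pose addc := perm (addIr c : injective (fun x : 'I_n.+1 => x + c)).
  rewrite /F (reindex_inj (mulIg addc)) /=; apply: eq_bigr => t _.
  congr (nat_of_bool (_ == _)); apply: eq_card => i.
  by rewrite !inE ffunE permM permE (inj_eq (addIr c)).
have sumF : (\sum_f F f = n.+1`! * ('C(n, k) * n ^ (n - k)))%N.
  rewrite exchange_big /= -card_Sn -sum_nat_const.
  by apply: eq_bigr => t _; rewrite card_agreements.
have Fpark f : park f -> F f = (\sum_(s : {perm 'I_n})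
    ((n.+1 - k) * (agreements f (fun i => lift ord_max (s i)) == k) +
     k.+1 * (agreements f (fun i => lift ord_max (s i)) == k.+1)))%N.
  move=> fpark; rewrite /F (reindex (insert_max n)) /=; last first.
    exact/onW_bij/insert_max_bij.
  rewrite -(pair_bigA _ (fun x s => nat_of_bool (agreements f
    (fun i => insert_max n (x, s) (lift ord_max i)) == k))) exchange_big /=.
  apply: eq_bigr => s _; rewrite -sum_card_remove; apply: eq_bigr => x _.
  by rewrite agreements_insert_max // => i; apply: park_neq_max.
apply/eqP; rewrite -(eqn_pmul2l (fact_gt0 n.+1)) -sumF (sum_park _ _ Ftrans).
rewrite factS -mulnA eqn_pmul2l // (eq_bigr _ Fpark) exchange_big /=.
rewrite -card_Sn -sum_nat_const; apply/eqP; apply: eq_bigr => s _.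
by rewrite big_split /= -!big_distrr /= !park_count_perm.
Qed.

(** * Solving the recurrence *)

Lemma park_count_closed n k : (k <= n.+1)%N ->
  (n.+1%:R ^+ 2 * (park_count n k)%:R : rat) =
    'C(n.+1, k)%:R * (n%:R ^+ (n.+1 - k)%N - (-1) ^+ (n.+1 - k)%N).
Proof.
(* Induction on m = n + 1 - k; at m = 0 both sides vanish, since n positions cannot give n + 1
   agreements. *)
move=> lek; rewrite -{1 2}(subKn lek); move: (n.+1 - k)%N (leq_subr k n.+1).
elim=> [_|m IHm ltm].
  rewrite subn0 !expr0 subrr mulr0 /park_count big1 ?mulr0 // => f _.
  by rewrite ltn_eqF // ltnS -[X in (_ <= X)%N]card_ord max_card.
have := IHm (ltnW ltm); rewrite -(subnSK ltm).
move: (n.+1 - m.+1)%N (leq_subr m.+1 n.+1) (subKn ltm) => j lej jE.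
have ltj : (j <= n)%N by lia.
have {jE} mE : (n - j = m)%N by lia.
have subE : (n.+1 - j = m.+1)%N by lia.
have := congr1 (fun x : nat => x%:R : rat) (park_count_rec n j).
have := congr1 (fun x : nat => x%:R : rat) (mul_bin_down n.+1 j).
have := congr1 (fun x : nat => x%:R : rat) (mul_bin_diag n.+1 j).
rewrite /= subE mE !natrM natrD !natrM natrX ![_ ^+ m.+1]exprS => e1 e2 e3 IH.
have m0 : (m.+1%:R : rat) != 0 by rewrite Num.Theory.pnatr_eq0.
(* The factor m + 1 lets both C(n+1, j) and C(n+1, j+1) be expressed through C(n, j). *)
apply: (mulfI m0); rewrite [RHS]mulrA -e2.
transitivity (n.+1%:R ^+ 2 * (m.+1%:R * (park_count n j)%:R +
    j.+1%:R * (park_count n j.+1)%:R) -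
    j.+1%:R * (n.+1%:R ^+ 2 * (park_count n j.+1)%:R) : rat); first by ring.
by rewrite e3 IH [X in _ - X]mulrA -e1 -natr1; ring.
Qed.

(** * From [park] back to sorted sequences of positive entries *)

Lemma nth_sort_leq (s : seq nat) i x : (i < size s)%N ->
  (nth 0%N (sort leq s) i <= x)%N = (i < count (leq^~ x) s)%N.
Proof.
move=> lti; have sorted_s : sorted leq (sort leq s) := sort_sorted leq_total s.
rewrite -(count_sort leq); apply/idP/idP => [|lti_count].
  apply: contraLR; rewrite -leqNgt -ltnNge => lec.
  apply: (@Order.TotalTheory.DualTotalTheory.nth_count_gt _ nat) => //.
  by rewrite size_sort lti andbT.
exact: (@Order.PreorderTheory.nth_count_le _ nat).
Qed.

(* Addition is cyclic: the value n, never taken by a parking function, becomes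
   the entry 0, which parking_function excludes. *)
Definition to_entries {n} (f : {ffun 'I_n -> 'I_n.+1}) : n.-tuple 'I_n.+1 :=
  [tuple f i + inord 1 | i < n].

Lemma to_entries_bij n : bijective (@to_entries n).
Proof.
exists (fun p => [ffun i => tnth p i - inord 1]) => [f | p].
  by apply/ffunP => i; rewrite ffunE tnth_mktuple addrK.
by apply: eq_from_tnth => i; rewrite tnth_mktuple ffunE subrK.
Qed.

Lemma val_to_entries n (x : 'I_n.+1) :
  (x + inord 1 : 'I_n.+1) = (if x == ord_max then 0 else x.+1)%N :> nat.
Proof.
(* In ['I_1], [inord 1] defaults to 0, so n = 0 is separate. *)
case: n x => [|n] x; first by rewrite !ord1.
rewrite /= inordK // addn1; case: eqVneq => [-> /= | neqx]; first by rewrite modnn.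
by rewrite modn_small // ltnS ltn_neqAle neqx /= -ltnS.
Qed.

Lemma nth_to_entries n (f : {ffun 'I_n -> 'I_n.+1}) (i : 'I_n) :
  nth 0%N [seq val x | x <- to_entries f] i =
  if f i == ord_max then 0%N else (f i).+1.
Proof.
rewrite (nth_map ord0) ?size_tuple // -tnth_nth tnth_mktuple.
exact: val_to_entries.
Qed.

(** A range over nat lets [size s] be rewritten to n without dependent types in the way. *)
Lemma fixed_points_count (s : seq nat) :
  #|fixed_points s| = (\sum_(0 <= i < size s) (nth 0 s i == i.+1))%N.
Proof.
by rewrite big_mkord -sum1dep_card big_mkcond; apply: eq_bigr => i _; case: eqP.
Qed.

Lemma parking_function_to_entries n (f : {ffun 'I_n -> 'I_n.+1}) :
  parking_function [seq val x | x <- to_entries f] = park f.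
Proof.
set s := [seq _ | _ <- _].
have size_s : size s = n by rewrite size_map size_tuple.
have nth_s (i : 'I_n) : nth 0%N s i = if f i == ord_max then 0%N else (f i).+1.
  exact: nth_to_entries.
have pos_s : all (leq 1) s = [forall i, f i != ord_max].
  apply/(all_nthP 0%N)/forallP => H i.
    have := H i; rewrite size_s nth_s => /(_ (ltn_ord i)).
    by case: eqP.
  rewrite size_s => lti; rewrite -[i]/(val (Ordinal lti)) nth_s.
  by rewrite (negPf (H _)).
(* Positivity is essential: an entry 0, wrapped from n, would be counted on the left only. *)
have count_s d : all (leq 1) s -> (d <= n)%N ->
    count (leq^~ d) s = below f (inord d).
  rewrite pos_s => /forallP fmax led; rewrite -sum1_count big_mkcond.
  rewrite (big_nth 0%N) size_s big_mkord; apply: eq_bigr => i _.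
  by rewrite nth_s (negPf (fmax i)) inordK //; case: ifP.
apply/andP/idP => [[pos /forallP H]|fpark].
  apply/forallP => d; case: d => [[|d] ltd] //=.
  have ltds : (d < size s)%N by rewrite size_s.
  have := H (Ordinal ltds); rewrite nth_sort_leq //= count_s //.
  by rewrite (_ : inord d.+1 = Ordinal ltd) //; apply: val_inj; rewrite /= inordK.
have pos : all (leq 1) s.
  by rewrite pos_s; apply/forallP => i; apply: park_neq_max.
split=> //; apply/forallP => d; have ltd : (d < n)%N by rewrite -size_s.
rewrite nth_sort_leq // count_s //.
by have /forallP/(_ (inord d.+1)) := fpark; rewrite inordK.
Qed.

Lemma fixed_points_to_entries n (f : {ffun 'I_n -> 'I_n.+1}) :
  #|fixed_points [seq val x | x <- to_entries f]| =
  agreements f (lift ord_max).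
Proof.
rewrite fixed_points_count size_map size_tuple big_mkord.
rewrite /agreements -sum1dep_card [RHS]big_mkcond; apply: eq_bigr => i _.
rewrite nth_to_entries -(inj_eq val_inj (f i) ord_max).
rewrite -(inj_eq val_inj (f i)) /= /bump leqNgt ltn_ord add0n.
have lti := ltn_ord i; case: (eqVneq (f i : nat) n) => [->|_].
  by rewrite (gtn_eqF lti).
by rewrite eqSS; case: eqP.
Qed.

Theorem theorem2p1 (n k : nat) (hn : (1 <= n)%N) (hk : (k <= n)%N) :
  (#|parking_functions_with_fixed_points n k|%:R : rat) =
    1 / (n.+1%:R ^+ 2) * 'C(n.+1, k)%:R *
    (n%:R ^+ (n - k + 1)%N - (-1) ^+ (n - k + 1)%N).
Proof.
have -> : #|parking_functions_with_fixed_points n k| = park_count n k.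
  rewrite -sum1dep_card (reindex (@to_entries n)) /=; last first.
    exact/onW_bij/to_entries_bij.
  rewrite /park_count big_mkcondr; apply: eq_big => f.
    exact: parking_function_to_entries.
  by rewrite fixed_points_to_entries; case: eqP.
rewrite addn1 -subSn // -mulrA -park_count_closed 1?leqW // mulrA div1r mulVf.
  by rewrite mul1r.
by rewrite expf_neq0 // Num.Theory.pnatr_eq0.
Qed.
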